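(* Let $\alpha,\beta,\gamma,\delta$ be sector angles of a spherical 4-bar linkage of elliptic type, i.e. satisfying $$\alpha,\beta,\gamma,\delta\in(0,\pi),\quad \alpha<\beta+\gamma+\delta<\alpha+2\pi,\quad \beta<\gamma+\delta+\alpha<\beta+2\pi,\quad \gamma<\delta+\alpha+\beta<\gamma+2\pi,\quad \delta<\alpha+\beta+\gamma<\delta+2\pi,$$ and $$\alpha-\beta+\gamma-\delta\neq0,\quad \alpha-\beta-\gamma+\delta\neq0,\quad \alpha+\beta-\gamma-\delta\neq0,\quad \alpha+\beta+\gamma+\delta\neq2\pi.$$ Put $\sigma=(\alpha+\beta+\gamma+\delta)/2$ and $$M=\frac{\sin\alpha\sin\beta\sin\gamma\sin\delta}{\sin(\sigma-\alpha)\sin(\sigma-\beta)\sin(\sigma-\gamma)\sin(\sigma-\delta)}.$$ Then: (i) there is a configuration with $x=\infty$ if and only if $(M-1)\operatorname{sign}(\pi-\sigma)\operatorname{sign}(\sigma-\alpha-\beta)<0$; (ii) there is a configuration with $y=\infty$ if and only if $(M-1)\operatorname{sign}(\pi-\sigma)\operatorname{sign}(\sigma-\beta-\gamma)<0$; (iii) there is a configuration with $z=\infty$ if and only if $(M-1)\operatorname{sign}(\pi-\sigma)\operatorname{sign}(\sigma-\gamma-\delta)<0$; (iv) there is a configuration with $w=\infty$ if and only if $(M-1)\operatorname{sign}(\pi-\sigma)\operatorname{sign}(\sigma-\delta-\alpha)<0$.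
   Context: A configuration of the spherical 4-bar linkage (degree-4 single-vertex rigid origami) with sector angles $\alpha,\beta,\gamma,\delta\in(0,\pi)$ is a quadruple of folding angles $(\rho_x,\rho_y,\rho_z,\rho_w)\in(\mathbb{R}/2\pi\mathbb{Z})^4$ satisfying the closure condition $$R_3(\alpha)R_1(\rho_x)R_3(\beta)R_1(\rho_y)R_3(\gamma)R_1(\rho_z)R_3(\delta)R_1(\rho_w)=I,$$ where $R_1(\theta),R_3(\theta)\in SO(3)$ are the rotations by $\theta$ about the first and third coordinate axes. (Panel $\alpha$ lies between creases $w$ and $x$, $\beta$ between $x$ and $y$, $\gamma$ between $y$ and $z$, $\delta$ between $z$ and $w$.) Configurations are recorded by $x=\tan(\rho_x/2)$, $y=\tan(\rho_y/2)$, $z=\tan(\rho_z/2)$, $w=\tan(\rho_w/2)$ in $\mathbb{R}\cup\{\infty\}$; a folding angle equal to $\pi$ corresponds to the value $\infty$. *)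

(* Defs.v *)
From HB Require Import structures.
From mathcomp Require Import all_boot all_order all_algebra.
From mathcomp Require Import all_classical all_reals all_analysis.

Set Implicit Arguments.
Unset Strict Implicit.
Unset Printing Implicit Defensive.

Import Order.TTheory GRing.Theory Num.Theory.
Local Open Scope ring_scope.

Definition mx3_of_seq (R : realType) (s : seq (seq R)) : 'M[R]_3 :=
  \matrix_(i < 3, j < 3) nth 0 (nth [::] s i) j.

(* Rotations by t about the first and third coordinate axes, acting on column
   vectors. *)
Definition rot1 (R : realType) (t : R) : 'M[R]_3 := mx3_of_seq
  [:: [:: 1;     0;       0];
      [:: 0; cos t; - sin t];
      [:: 0; sin t;   cos t]].

Definition rot3 (R : realType) (t : R) : 'M[R]_3 := mx3_of_seq
  [:: [:: cos t; - sin t; 0];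
      [:: sin t;   cos t; 0];
      [::     0;       0; 1]].

(* Folding angles live in R / 2 pi Z and are given here by arbitrary real
   representatives; by rot1D2pi and half_tanD2pi below, configuration and
   half_tan depend only on the classes modulo 2 pi. *)
Definition configuration (R : realType) (alpha beta gamma delta : R)
    (rhox rhoy rhoz rhow : R) : Prop :=
  rot3 alpha *m rot1 rhox *m rot3 beta *m rot1 rhoy *m
  rot3 gamma *m rot1 rhoz *m rot3 delta *m rot1 rhow = 1%:M.

(* tan (rho / 2) in the projective line, with None standing for infinity. The
   test is needed because tan is totalized: tan (pi / 2) = 0. *)
Definition half_tan (R : realType) (rho : R) : option R :=
  if cos (rho / 2) == 0 then None else Some (tan (rho / 2)).

Definition half_perimeter (R : realType) (alpha beta gamma delta : R) : R :=
  (alpha + beta + gamma + delta) / 2.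

Definition linkage_M (R : realType) (alpha beta gamma delta : R) : R :=
  let sigma := half_perimeter alpha beta gamma delta in
  (sin alpha * sin beta * sin gamma * sin delta) /
  (sin (sigma - alpha) * sin (sigma - beta) *
   sin (sigma - gamma) * sin (sigma - delta)).

Definition is_linkage (R : realType) (alpha beta gamma delta : R) : Prop :=
  [/\ 0 < alpha < pi, 0 < beta < pi, 0 < gamma < pi & 0 < delta < pi] /\
  [/\ alpha < beta + gamma + delta < alpha + 2 * pi,
      beta < gamma + delta + alpha < beta + 2 * pi,
      gamma < delta + alpha + beta < gamma + 2 * pi &
      delta < alpha + beta + gamma < delta + 2 * pi].

Definition elliptic_type (R : realType) (alpha beta gamma delta : R) : Prop :=
  is_linkage alpha beta gamma delta /\
  [/\ alpha - beta + gamma - delta != 0,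
      alpha - beta - gamma + delta != 0,
      alpha + beta - gamma - delta != 0 &
      alpha + beta + gamma + delta != 2 * pi].

Lemma rot1D2pi (R : realType) (t : R) : rot1 (t + 2 * pi) = rot1 t.
Proof. by rewrite /rot1 mulr_natl cosD2pi sinD2pi. Qed.

Lemma half_tanD2pi (R : realType) (t : R) : half_tan (t + 2 * pi) = half_tan t.
Proof.
have e : (t + 2 * pi) / 2 = t / 2 + pi by rewrite mulrDl mulrAC divff ?mul1r.
by rewrite /half_tan e cosDpi tanDpi oppr_eq0.
Qed.

Lemma half_tan_pi (R : realType) : half_tan (pi : R) = None.
Proof. by rewrite /half_tan cos_pihalf eqxx. Qed.

(* Main.v *)
Require Import Defs.
From HB Require Import structures.
From mathcomp Require Import all_boot all_order all_algebra.
From mathcomp Require Import all_classical all_reals all_analysis.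
From mathcomp Require Import ring lra.

(** Folding a crease flat, [rho_x = pi], turns the linkage into a spherical
    triangle with sides [|alpha - beta|], [gamma], [delta], because the half-turn
    conjugates [rot3 beta] into [rot3 (- beta)]. Such a triangle exists iff
    [cos (gamma + delta) <= cos (alpha - beta) <= cos (gamma - delta)]; the left
    inequality follows from the linkage inequalities. The identity
      [prod sin alpha_i - prod sin (sigma - alpha_i) = - sin sigma *
       sin (sigma - alpha - beta) * sin (sigma - alpha - gamma) *
       sin (sigma - alpha - delta)]
    together with
      [cos (gamma - delta) - cos (alpha - beta) =
       2 * sin (sigma - alpha - gamma) * sin (sigma - alpha - delta)]
    turns the right one into the sign condition on [M - 1]. The other three
    creases follow by cyclic symmetry of the closure condition. *)

Set Implicit Arguments.
Unset Strict Implicit.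
Unset Printing Implicit Defensive.

Import Order.TTheory GRing.Theory Num.Theory.
Local Open Scope ring_scope.

(** * 3-by-3 rotation matrices and Euler angles *)

Section Rotations.
Variable R : realType.
Implicit Types (a b c t : R) (A B : 'M[R]_3).

Lemma mx3_of_seqE A : A = mx3_of_seq
  [:: [:: A 0 0; A 0 1; A 0 2%:R];
      [:: A 1 0; A 1 1; A 1 2%:R];
      [:: A 2%:R 0; A 2%:R 1; A 2%:R 2%:R]].
Proof.
apply/matrixP => i j; rewrite mxE.
by case: i => [[|[|[|//]]] ?]; case: j => [[|[|[|//]]] ?] /=;
  congr (A _ _); apply/val_inj.
Qed.

Lemma mulmx3E A B i j :
  (A *m B) i j = A i 0 * B 0 j + A i 1 * B 1 j + A i 2%:R * B 2%:R j.
Proof.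
rewrite !mxE !big_ord_recl big_ord0 addr0 addrA.
by congr (_ + _ * _ + _ * _); congr (_ _ _); apply/val_inj.
Qed.

Lemma mx3_of_seqM (a b c d e f g h k a' b' c' d' e' f' g' h' k' : R) :
  mx3_of_seq [:: [:: a; b; c]; [:: d; e; f]; [:: g; h; k]] *m
  mx3_of_seq [:: [:: a'; b'; c']; [:: d'; e'; f']; [:: g'; h'; k']] =
  mx3_of_seq
   [:: [:: a * a' + b * d' + c * g'; a * b' + b * e' + c * h';
           a * c' + b * f' + c * k'];
       [:: d * a' + e * d' + f * g'; d * b' + e * e' + f * h';
           d * c' + e * f' + f * k'];
       [:: g * a' + h * d' + k * g'; g * b' + h * e' + k * h';
           g * c' + h * f' + k * k']].
Proof. by rewrite [LHS]mx3_of_seqE !mulmx3E /mx3_of_seq !mxE. Qed.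

Lemma mx3_of_seq1 : 1%:M = mx3_of_seq [:: [:: 1; 0; 0]; [:: 0; 1; 0]; [:: 0; 0; 1]]
  :> 'M[R]_3.
Proof. by rewrite [LHS]mx3_of_seqE !mxE. Qed.

Lemma det_mx3_of_seq (a b c d e f g h k : R) :
  \det (mx3_of_seq [:: [:: a; b; c]; [:: d; e; f]; [:: g; h; k]]) =
  a * (e * k - f * h) - b * (d * k - f * g) + c * (d * h - e * g).
Proof.
rewrite (expand_det_row _ 0) !big_ord_recl big_ord0 /cofactor.
rewrite !(expand_det_row _ 0) !big_ord_recl !big_ord0 /cofactor !det_mx11 !mxE /=.
rewrite /bump /=; ring.
Qed.

Lemma rot1D a b : rot1 (a + b) = rot1 a *m rot1 b.
Proof.
by rewrite mx3_of_seqM /rot1 cosD sinD; congr mx3_of_seq;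
  do !congr cons; ring.
Qed.

Lemma rot3D a b : rot3 (a + b) = rot3 a *m rot3 b.
Proof.
by rewrite mx3_of_seqM /rot3 cosD sinD; congr mx3_of_seq;
  do !congr cons; ring.
Qed.

Lemma rot1_0 : rot1 (0 : R) = 1%:M.
Proof. by rewrite /rot1 cos0 sin0 oppr0 mx3_of_seq1. Qed.

Lemma rot3_0 : rot3 (0 : R) = 1%:M.
Proof. by rewrite /rot3 cos0 sin0 oppr0 mx3_of_seq1. Qed.

Lemma rot1K a : rot1 (- a) *m rot1 a = 1%:M.
Proof. by rewrite -rot1D addNr rot1_0. Qed.

Lemma rot1NK a : rot1 a *m rot1 (- a) = 1%:M.
Proof. by rewrite -rot1D addrN rot1_0. Qed.

Lemma rot3K a : rot3 (- a) *m rot3 a = 1%:M.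
Proof. by rewrite -rot3D addNr rot3_0. Qed.

Lemma rot3NK a : rot3 a *m rot3 (- a) = 1%:M.
Proof. by rewrite -rot3D addrN rot3_0. Qed.

Lemma tr_rot1 a : (rot1 a)^T = rot1 (- a).
Proof. by rewrite [LHS]mx3_of_seqE /rot1 !mxE cosN sinN opprK. Qed.

Lemma tr_rot3 a : (rot3 a)^T = rot3 (- a).
Proof. by rewrite [LHS]mx3_of_seqE /rot3 !mxE cosN sinN opprK. Qed.

Definition rotation A := A *m A^T = 1%:M /\ \det A = 1.

Lemma rotationM A B : rotation A -> rotation B -> rotation (A *m B).
Proof.
move=> [oA dA] [oB dB]; split; last by rewrite det_mulmx dA dB mulr1.
by rewrite trmx_mul mulmxA -(mulmxA A) oB mulmx1.
Qed.

Lemma rotation_rot1 a : rotation (rot1 a).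
Proof.
split; first by rewrite tr_rot1 rot1NK.
by rewrite det_mx3_of_seq -[RHS](cos2Dsin2 a); ring.
Qed.

Lemma rotation_rot3 a : rotation (rot3 a).
Proof.
split; first by rewrite tr_rot3 rot3NK.
by rewrite det_mx3_of_seq -[RHS](cos2Dsin2 a); ring.
Qed.

(** Orthogonality of the rows, then of the columns, is linear in each remaining entry with
    coefficient [sin b] up to sign, which fixes all of them except the corner; the determinant fixes
    that one. *)
Lemma rotation_eq_rot3 A b : rotation A -> sin b != 0 ->
  A 0 0 = cos b -> A 0 1 = - sin b -> A 0 2%:R = 0 ->
  A 1 0 = sin b -> A 2%:R 0 = 0 -> A = rot3 b.
Proof.
move=> [oA dA] sb0 a00 a01 a02 a10 a20.
have a11 : A 1 1 = cos b.
  have /matrixP/(_ 0 1) := oA; rewrite mulmx3E !mxE a00 a01 a02 a10 /= => e.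
  by apply: (mulfI sb0); lra.
have a21 : A 2%:R 1 = 0.
  have /matrixP/(_ 0 2%:R) := oA; rewrite mulmx3E !mxE a00 a01 a02 a20 /= => e.
  by apply: (mulfI sb0); lra.
have a12 : A 1 2%:R = 0.
  have /matrixP/(_ 0 2%:R) := mulmx1C oA; rewrite mulmx3E !mxE a00 a02 a10 a20 /= => e.
  by apply: (mulfI sb0); lra.
have a22 : A 2%:R 2%:R = 1.
  rewrite -dA [A in RHS]mx3_of_seqE det_mx3_of_seq a00 a01 a02 a10 a11 a12 a20 a21.
  by rewrite -[LHS]mul1r -[X in X * _](cos2Dsin2 b); ring.
by rewrite [LHS]mx3_of_seqE a00 a01 a02 a10 a11 a12 a20 a21 a22.
Qed.

Lemma cos_sin_exists (u v : R) : u ^+ 2 + v ^+ 2 = 1 ->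
  exists t, cos t = u /\ sin t = v.
Proof.
move=> uv1.
have u1 : -1 <= u <= 1 by apply/andP; split; nra.
have sv : sin (acos u) = `|v|.
  by rewrite sin_acos // -uv1 addrC addKr sqrtr_sqr.
have [v0|v0] := lerP 0 v.
  by exists (acos u); rewrite acosK // sv ger0_norm.
by exists (- acos u); rewrite cosN sinN acosK // sv ltr0_norm // opprK.
Qed.

(** Euler angles. The first row and first column of [A] are unit vectors, so outside the shared
    entry [cos b] each has norm [|sin b|]; [t] and [s] are their polar angles, and undoing them
    leaves [rot3 b]. *)
Lemma rotation_euler A b : rotation A -> A 0 0 = cos b -> sin b != 0 ->
  exists s t, A = rot1 s *m rot3 b *m rot1 t.
Proof.
move=> rA a00 sb0; have [oA _] := rA.
have sb20 : sin b ^+ 2 != 0 by rewrite expf_neq0.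
(* The signs match the first row [(cos b, - sin b * cos t, sin b * sin t)] and first column
   [(cos b, sin b * cos s, sin b * sin s)] of the target product. *)
have row0 : (- A 0 1 / sin b) ^+ 2 + (A 0 2%:R / sin b) ^+ 2 = 1.
  have /matrixP/(_ 0 0) := oA; rewrite mulmx3E !mxE a00 /= => e.
  rewrite !expr_div_n -mulrDl; apply: (mulIf sb20); rewrite divfK // mul1r.
  by apply: (addrI (cos b ^+ 2)); rewrite cos2Dsin2 -[RHS]e; ring.
have col0 : (A 1 0 / sin b) ^+ 2 + (A 2%:R 0 / sin b) ^+ 2 = 1.
  have /matrixP/(_ 0 0) := mulmx1C oA; rewrite mulmx3E !mxE a00 /= => e.
  rewrite !expr_div_n -mulrDl; apply: (mulIf sb20); rewrite divfK // mul1r.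
  by apply: (addrI (cos b ^+ 2)); rewrite cos2Dsin2 -[RHS]e; ring.
have [t [ct st]] := cos_sin_exists row0.
have [s [cs ss]] := cos_sin_exists col0.
exists s, t.
suff <- : rot1 (- s) *m A *m rot1 (- t) = rot3 b.
  by rewrite !mulmxA rot1NK mul1mx -mulmxA rot1K mulmx1.
have a01 : A 0 1 = - (sin b * cos t) by rewrite ct; field.
have a02 : A 0 2%:R = sin b * sin t by rewrite st; field.
have a10 : A 1 0 = sin b * cos s by rewrite cs; field.
have a20 : A 2%:R 0 = sin b * sin s by rewrite ss; field.
have cs1 := cos2Dsin2 s; have ct1 := cos2Dsin2 t.
apply: rotation_eq_rot3 => //.
- by do !apply: rotationM => //; exact: rotation_rot1.
all: rewrite !mulmx3E /rot1 !mxE /= ?a00 ?a01 ?a02 ?a10 ?a20 ?cosN ?sinN.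
- by ring.
- by rewrite -[RHS]mulr1 -[X in _ = _ * X]ct1; ring.
- by ring.
- by rewrite -[RHS]mulr1 -[X in _ = _ * X]cs1; ring.
- by ring.
Qed.

(** * Flat creases and closure of spherical triangles *)

Lemma flat_angle t : half_tan t = None -> cos t = -1 /\ sin t = 0.
Proof.
rewrite /half_tan; case: eqP => // c0 _.
have -> : t = (t / 2) *+ 2 by rewrite -mulr_natr divfK.
by rewrite cos_mulr2n sin_mulr2n c0 expr0n mul0r !mul0rn add0r.
Qed.

Lemma rot1_flat_rot3 t b : half_tan t = None ->
  rot1 t *m rot3 b = rot3 (- b) *m rot1 t.
Proof.
move=> /flat_angle[ct st].
rewrite !mx3_of_seqM /rot1 /rot3 ct st cosN sinN.
by congr mx3_of_seq; do !congr cons; ring.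
Qed.

(** Closure of a spherical three-bar linkage. The sides are signed, as the first one will be a
    difference of sector angles. *)
Definition triangle_closes a b c : Prop := exists rho1 rho2 rho3 : R,
  rot3 a *m rot1 rho1 *m rot3 b *m rot1 rho2 *m rot3 c *m rot1 rho3 = 1%:M.

Lemma configuration_flat_x a b c d :
  (exists rhox rhoy rhoz rhow : R,
     configuration a b c d rhox rhoy rhoz rhow /\ half_tan rhox = None) <->
  triangle_closes (a - b) c d.
Proof.
split=> [[x [y [z [w [conf flat]]]]]|[y [z [w clos]]]].
  exists (x + y), z, w; rewrite rot3D rot1D !mulmxA -[RHS]conf.
  do 5![congr (_ *m _)].
  by rewrite -!mulmxA; congr (_ *m _); rewrite rot1_flat_rot3.
(* The half-turn moved past [rot3 b] is absorbed by the next crease, hence the shift by [- pi]. *)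
exists pi, (- pi + y), z, w; split; last exact: half_tan_pi.
rewrite /configuration -[RHS]clos -(mulmxA (rot3 a)) rot1_flat_rot3 ?half_tan_pi //.
by rewrite mulmxA -rot3D -[_ *m rot1 pi *m _]mulmxA -rot1D addNKr.
Qed.

(** Spherical law of cosines; the minus sign appears because [t] is a folding angle, supplementary
    to the interior angle. Multiplying by [rot1] on either side preserves the entry at (0, 0), so
    comparing this entry eliminates the other two folding angles. *)
Lemma triangle_closes_cos a b c : triangle_closes a b c ->
  exists t, cos a = cos b * cos c - sin b * sin c * cos t.
Proof.
move=> [y [z [w clos]]]; exists z.
pose N := rot3 b *m rot1 z *m rot3 c.
have {}clos : rot3 a *m (rot1 y *m (N *m rot1 w)) = 1%:M by rewrite -clos !mulmxA.
have := congr1 (fun X => rot1 (- y) *m (rot3 (- a) *m X) *m rot1 (- w)) clos.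
rewrite mulmx1 (mulmxA (rot3 (- a)) (rot3 a)) rot3K mul1mx.
rewrite (mulmxA (rot1 (- y)) (rot1 y)) rot1K mul1mx -(mulmxA N) rot1NK mulmx1.
move=> /matrixP/(_ 0 0).
rewrite !mulmx3E /rot1 /rot3 !mxE /= cosN => e00.
lra.
Qed.

(** The law of cosines gives [rot3 b *m rot1 t *m rot3 c] the corner entry [cos (- a)]; its Euler
    decomposition around [rot3 (- a)] supplies the two other folding angles. *)
Lemma triangle_closesP a b c t : sin a != 0 ->
  cos a = cos b * cos c - sin b * sin c * cos t -> triangle_closes a b c.
Proof.
move=> sa0 ca.
have [|||s [u e]] := @rotation_euler (rot3 b *m rot1 t *m rot3 c) (- a).
- by do !apply: rotationM; do ?[exact: rotation_rot1 | exact: rotation_rot3].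
- by rewrite !mulmx3E /rot1 /rot3 !mxE /= cosN ca; ring.
- by rewrite sinN oppr_eq0.
exists (- s), t, (- u).
have -> : rot3 a *m rot1 (- s) *m rot3 b *m rot1 t *m rot3 c =
          rot3 a *m rot1 (- s) *m (rot3 b *m rot1 t *m rot3 c) by rewrite !mulmxA.
rewrite e !mulmxA -(mulmxA (rot3 a)) rot1K mulmx1 rot3NK mul1mx rot1NK //.
Qed.

(** As [cos t] runs through [-1, 1], the right side of the law of cosines runs from [cos (b + c)] to
    [cos (b - c)]. Excluding equality at the upper end makes the criterion strict. *)
Lemma triangle_closes_iff a b c : 0 < b < pi -> 0 < c < pi ->
  cos (b + c) < cos a -> cos (b - c) != cos a ->
  triangle_closes a b c <-> cos a < cos (b - c).
Proof.
move=> /sin_gt0_pi sb /sin_gt0_pi sc lo ne.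
have sbc := mulr_gt0 sb sc.
split=> [/triangle_closes_cos[t ca]|hi].
  have ct := cos_geN1 t.
  by rewrite lt_neqAle eq_sym ne cosB ca /=; nra.
(* Otherwise [cos a] would be 1 or -1, impossible strictly between two cosines. *)
have sa0 : sin a != 0.
  apply/eqP => sa0; have := cos2Dsin2 a; rewrite sa0 expr0n addr0 => ca2.
  have := cos_le1 (b - c); have := cos_geN1 (b + c); nra.
pose u := (cos b * cos c - cos a) / (sin b * sin c).
have ub : u * (sin b * sin c) = cos b * cos c - cos a by rewrite divfK ?gt_eqF.
rewrite cosD in lo; rewrite cosB in hi.
have u1 : -1 <= u <= 1 by apply/andP; split; nra.
apply: (@triangle_closesP _ _ _ (acos u)) => //.
by rewrite acosK // [_ * u]mulrC ub; ring.
Qed.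

End Rotations.

(** * Trigonometric identities and the sign condition *)

Section Linkage.
Variable R : realType.
Implicit Types a b c d t x y : R.

Lemma sin_mul_sin x y : sin x * sin y = (cos (x - y) - cos (x + y)) / 2.
Proof. by rewrite cosB cosD; field. Qed.

Lemma sgr_sin t : - pi < t < pi -> Num.sg (sin t) = Num.sg t.
Proof.
move=> /andP[t1 t2]; case: (sgrP t) => [->|t0|t0].
- by rewrite sin0 sgr0.
- by rewrite gtr0_sg // sin_gt0_pi ?t0.
- by rewrite ltr0_sg // -oppr_gt0 -sinN sin_gt0_pi // oppr_gt0 t0 ltrNl.
Qed.

Lemma sin_half_neq0 t : t != 0 -> - (2 * pi) < t < 2 * pi -> sin (t / 2) != 0.
Proof.
move=> t0 /andP[t1 t2]; rewrite -sgr_eq0 sgr_sin ?sgr_eq0; last lra.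
by rewrite mulf_neq0.
Qed.

(** With p, q, r, t the cosines of [a - b], [a + b], [c - d], [c + d], product-to-sum formulas
    reduce this to (p - q)(r - t) - (p - t)(r - q) = - (q - t)(r - p). *)
Lemma sin_prod_sub a b c d (s := half_perimeter a b c d) :
  sin a * sin b * sin c * sin d -
  sin (s - a) * sin (s - b) * sin (s - c) * sin (s - d) =
  - (sin s * sin (s - a - b) * (sin (s - a - c) * sin (s - a - d))).
Proof.
rewrite -[_ * sin (s - c) * _]mulrA !sin_mul_sin.
have -> : s - a - (s - b) = b - a by ring.
have -> : s - a + (s - b) = c + d by rewrite /s /half_perimeter; field.
have -> : s - c - (s - d) = d - c by ring.
have -> : s - c + (s - d) = a + b by rewrite /s /half_perimeter; field.
have -> : s - (s - a - b) = a + b by ring.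
have -> : s + (s - a - b) = c + d by rewrite /s /half_perimeter; field.
have -> : s - a - c - (s - a - d) = d - c by ring.
have -> : s - a - c + (s - a - d) = b - a by rewrite /s /half_perimeter; field.
by rewrite !cosB !cosD; field.
Qed.

Lemma flat_x_iff a b c d (s := half_perimeter a b c d) : elliptic_type a b c d ->
  (exists rhox rhoy rhoz rhow : R,
     configuration a b c d rhox rhoy rhoz rhow /\ half_tan rhox = None) <->
  (linkage_M a b c d - 1) * Num.sg (pi - s) * Num.sg (s - a - b) < 0.
Proof.
move=> [[[ha hb hc hd] [la lb lc ld]] [n1 n2 n3 n4]].
(* [s - a] is half of [b + c + d - a], which the linkage inequalities place between 0 and [2 * pi];
   likewise for the other three. *)
have sa : 0 < sin (s - a) by apply: sin_gt0_pi; rewrite /s /half_perimeter; lra.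
have sb : 0 < sin (s - b) by apply: sin_gt0_pi; rewrite /s /half_perimeter; lra.
have sc : 0 < sin (s - c) by apply: sin_gt0_pi; rewrite /s /half_perimeter; lra.
have sd : 0 < sin (s - d) by apply: sin_gt0_pi; rewrite /s /half_perimeter; lra.
have lo : cos (a - b) - cos (c + d) = 2 * (sin (s - a) * sin (s - b)).
  rewrite sin_mul_sin mulrC divfK // -[a - b]opprB cosN.
  by congr (cos _ - cos _); rewrite /s /half_perimeter; field.
have hi : cos (c - d) - cos (a - b) = 2 * (sin (s - a - c) * sin (s - a - d)).
  rewrite sin_mul_sin mulrC divfK // -[c - d]opprB cosN -[a - b]opprB cosN.
  by congr (cos _ - cos _); rewrite /s /half_perimeter; field.
(* Ellipticity keeps these three half-combinations away from the zeros of sine. *)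
have nac : sin (s - a - c) != 0.
  have -> : s - a - c = - (a - b + c - d) / 2 by rewrite /s /half_perimeter; field.
  by apply: sin_half_neq0; [rewrite oppr_eq0|lra].
have nad : sin (s - a - d) != 0.
  have -> : s - a - d = - (a - b - c + d) / 2 by rewrite /s /half_perimeter; field.
  by apply: sin_half_neq0; [rewrite oppr_eq0|lra].
have nab : sin (s - a - b) != 0.
  have -> : s - a - b = - (a + b - c - d) / 2 by rewrite /s /half_perimeter; field.
  by apply: sin_half_neq0; [rewrite oppr_eq0|lra].
(* Since [s] lies between 0 and [2 * pi], [pi - s] lies where sine has the sign of its argument. *)
have sgs : Num.sg (pi - s) = Num.sg (sin s).
  have -> : sin s = sin (pi - s) by rewrite sinB sinpi cospi; ring.
  by rewrite sgr_sin // /s /half_perimeter; lra.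
have ns : sin s != 0.
  rewrite -sgr_eq0 -sgs sgr_eq0; apply: contra n4 => /eqP e.
  by apply/eqP; move: e; rewrite /s /half_perimeter => e; lra.
have sgab : Num.sg (s - a - b) = Num.sg (sin (s - a - b)).
  by rewrite sgr_sin // /s /half_perimeter; lra.
rewrite configuration_flat_x triangle_closes_iff //; first last.
- by rewrite -subr_eq0 hi !mulf_neq0.
- by rewrite -subr_gt0 lo !mulr_gt0.
rewrite -subr_gt0 hi sgs sgab -sgr_lt0 !sgrM !sgr_id -!sgrM sgr_lt0.
set P := sin (s - a) * sin (s - b) * sin (s - c) * sin (s - d).
have P0 : 0 < P by rewrite !mulr_gt0.
(* Multiplying [M - 1] by [sin s * sin (s - a - b)] completes a square, so the result is a negative
   multiple of [cos (c - d) - cos (a - b)]. *)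
have -> : (linkage_M a b c d - 1) * sin s * sin (s - a - b) =
   - ((sin s * sin (s - a - b)) ^+ 2 / (2 * P)) *
   (2 * (sin (s - a - c) * sin (s - a - d))).
  rewrite /linkage_M -/s -/P.
  have -> : sin a * sin b * sin c * sin d =
     P - sin s * sin (s - a - b) * (sin (s - a - c) * sin (s - a - d)).
    by rewrite -[LHS](subrK P) sin_prod_sub -/s; ring.
  by field; rewrite gt_eqF.
rewrite nmulr_rlt0 // oppr_lt0; apply: divr_gt0; last exact: mulr_gt0.
by rewrite exprn_even_gt0 //= mulf_neq0.
Qed.

(** * Cyclic symmetry *)

Lemma elliptic_type_cyc a b c d : elliptic_type a b c d -> elliptic_type b c d a.
Proof.
move=> [[[? ? ? ?] [? ? ? ?]] [n1 n2 n3 n4]].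
split; first by split; split=> //; lra.
split.
- by apply: contra n1 => /eqP e; apply/eqP; lra.
(* The shift exchanges the second and third conditions, up to sign. *)
- by apply: contra n3 => /eqP e; apply/eqP; lra.
- by apply: contra n2 => /eqP e; apply/eqP; lra.
- by apply: contra n4 => /eqP e; apply/eqP; lra.
Qed.

Lemma half_perimeter_cyc a b c d : half_perimeter b c d a = half_perimeter a b c d.
Proof. by rewrite /half_perimeter; congr (_ / 2); ring. Qed.

Lemma linkage_M_cyc a b c d : linkage_M b c d a = linkage_M a b c d.
Proof. by rewrite /linkage_M half_perimeter_cyc; congr (_ / _); ring. Qed.

(** A right inverse of a square matrix is a left inverse, so the leading factors [rot3 a *m rot1 x]
    can move to the end. *)
Lemma configuration_cyc a b c d x y z w :
  configuration a b c d x y z w -> configuration b c d a y z w x.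
Proof.
rewrite /configuration => conf.
have := @mulmx1C _ _ (rot3 a *m rot1 x) (rot3 b *m rot1 y *m
  rot3 c *m rot1 z *m rot3 d *m rot1 w).
by rewrite !mulmxA; apply.
Qed.

End Linkage.

Theorem mainTheorem12 (R : realType) (alpha beta gamma delta : R)
    (Hell : elliptic_type alpha beta gamma delta) :
  let sigma := half_perimeter alpha beta gamma delta in
  let M := linkage_M alpha beta gamma delta in
  [/\ (exists rhox rhoy rhoz rhow : R,
         configuration alpha beta gamma delta rhox rhoy rhoz rhow /\
         half_tan rhox = None) <->
      (M - 1) * Num.sg (pi - sigma) * Num.sg (sigma - alpha - beta) < 0,
      (exists rhox rhoy rhoz rhow : R,
         configuration alpha beta gamma delta rhox rhoy rhoz rhow /\
         half_tan rhoy = None) <->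
      (M - 1) * Num.sg (pi - sigma) * Num.sg (sigma - beta - gamma) < 0,
      (exists rhox rhoy rhoz rhow : R,
         configuration alpha beta gamma delta rhox rhoy rhoz rhow /\
         half_tan rhoz = None) <->
      (M - 1) * Num.sg (pi - sigma) * Num.sg (sigma - gamma - delta) < 0 &
      (exists rhox rhoy rhoz rhow : R,
         configuration alpha beta gamma delta rhox rhoy rhoz rhow /\
         half_tan rhow = None) <->
      (M - 1) * Num.sg (pi - sigma) * Num.sg (sigma - delta - alpha) < 0].
Proof.
have Hell2 := elliptic_type_cyc Hell.
have Hell3 := elliptic_type_cyc Hell2.
have Hell4 := elliptic_type_cyc Hell3.
move=> sigma M; split.
- exact: flat_x_iff.
(* One shift makes [y] the leading crease. Four shifts are the identity, so the way back takes
   three. *)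
- have := flat_x_iff Hell2; rewrite linkage_M_cyc half_perimeter_cyc => <-.
  split=> -[x [y [z [w [conf flat]]]]].
    by exists y, z, w, x; split=> //; apply: configuration_cyc.
  by exists w, x, y, z; split=> //; do 3 apply: configuration_cyc.
- have := flat_x_iff Hell3; rewrite 2!linkage_M_cyc 2!half_perimeter_cyc => <-.
  split=> -[x [y [z [w [conf flat]]]]];
  by exists z, w, x, y; split=> //; do 2 apply: configuration_cyc.
- have := flat_x_iff Hell4; rewrite 3!linkage_M_cyc 3!half_perimeter_cyc => <-.
  split=> -[x [y [z [w [conf flat]]]]].
    by exists w, x, y, z; split=> //; do 3 apply: configuration_cyc.
  by exists y, z, w, x; split=> //; apply: configuration_cyc.
Qed.
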